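(* Let $a\ge2$ be an integer. The subtraction game $\mathcal{S}(a,2a+1,3a+2)$ is periodic with period $4a+2$ and nim-sequence $0^a1^a\,0\,2^{a-1}\,1\,0\,3^{a-2}\,2\,1$. Moreover, the subtraction set is non-expandable.
   Context: For a finite set $S$ of positive integers, the subtraction game $\mathcal{S}(S)$ is played on a single pile: two players alternately remove $s\in S$ coins (at most the pile size); the last mover wins. The nim-value is $\mathcal{G}(n)=\operatorname{mex}\{\mathcal{G}(n-s): s\in S, s\le n\}$. Words of single digits are written by juxtaposition, and $x^m$ denotes $m$-fold repetition of the block $x$ ($x^0$ empty). ''The game is periodic with period $p$ and nim-sequence $W$'' ($W$ a word of length $p$) means $\mathcal{G}(n+p)=\mathcal{G}(n)$ for all $n\ge0$, $p$ is the least such, and $\mathcal{G}(n)$ is the $((n\bmod p)+1)$-st letter of $W$ for all $n\ge0$. The expansion of $S$ is $S^{ex}=\{s\ge1:\mathcal{G}(n+s)\ne\mathcal{G}(n)\ \forall n\ge0\}$. For a set $X$ and $p\ge1$, $X^{*p}=\{x+mp:x\in X,m\ge0\}$. $S$ is non-expandable if $S^{ex}=S$ or $S^{ex}=S^{*p}$, $p$ the period. *)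

(* Defs.v *)
From HB Require Import structures.
From mathcomp Require Import all_boot.
From mathcomp Require Import finmap.
From mathcomp Require Import boolp classical_sets.

Set Implicit Arguments.
Unset Strict Implicit.
Unset Printing Implicit Defensive.

Local Open Scope classical_set_scope.
Local Open Scope nat_scope.

(* Some m <= size s is missing from s, so the bounded search succeeds
   (see mexP). *)
Definition mex (s : seq nat) : nat :=
  find [pred m | m \notin s] (iota 0 (size s).+1).

Lemma mexP (s : seq nat) :
  mex s \notin s /\ (forall m, m < mex s -> m \in s).
Proof.
have hs : has [pred m | m \notin s] (iota 0 (size s).+1).
  apply: contraT => /hasPn h.
  have sub : {subset iota 0 (size s).+1 <= s}.
    by move=> m /h /=; rewrite negbK.
  by have := uniq_leq_size (iota_uniq _ _) sub; rewrite size_iota ltnn.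
have lt_mex : mex s < (size s).+1.
  by move: (hs); rewrite has_find size_iota.
split=> [|m lt_m].
  by have := nth_find 0 hs; rewrite -/(mex s) nth_iota.
have := before_find 0 lt_m; rewrite nth_iota ?(ltn_trans lt_m) //= add0n.
by move/negbFE.
Qed.

(* The table [:: G(0); ...; G(n-1)].  A subtraction set contains only positive
   integers; under this condition nim_valueE is the usual recurrence, whereas
   for 0 \in S the value is meaningless. *)
Fixpoint nim_values (S : {fset nat}) (n : nat) : seq nat :=
  if n is k.+1 then
    let g := nim_values S k in
    rcons g (mex [seq nth 0 g (k - s) | s <- S & s <= k])
  else [::].

Definition nim_value (S : {fset nat}) (n : nat) : nat :=
  nth 0 (nim_values S n.+1) n.

Lemma size_nim_values (S : {fset nat}) (n : nat) : size (nim_values S n) = n.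
Proof. by elim: n => //= n IHn; rewrite size_rcons IHn. Qed.

Lemma nth_nim_values (S : {fset nat}) (n k : nat) :
  k < n -> nth 0 (nim_values S n) k = nim_value S k.
Proof.
elim: n => // n IHn; rewrite ltnS leq_eqVlt => /predU1P[-> //|lt_kn].
by rewrite /= nth_rcons size_nim_values lt_kn IHn.
Qed.

Lemma nim_valueE (S : {fset nat}) (n : nat) : 0 \notin S ->
  nim_value S n = mex [seq nim_value S (n - s) | s <- S & s <= n].
Proof.
move=> S0; rewrite {1}/nim_value /= nth_rcons size_nim_values ltnn eqxx.
congr mex; apply/eq_in_map => s; rewrite mem_filter => /andP[le_sn sS].
apply: nth_nim_values; case: s sS le_sn => [s0|s _ le_sn]; last first.
  by rewrite ltn_subrL (leq_ltn_trans _ le_sn).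
by case/negP: S0.
Qed.

Definition is_period (S : {fset nat}) (p : nat) : Prop :=
  0 < p /\ forall n, nim_value S (n + p) = nim_value S n.

(* Pure periodicity: there is no preperiod. *)
Definition periodic_with_period (S : {fset nat}) (p : nat) : Prop :=
  is_period S p /\ forall q, is_period S q -> p <= q.

Definition has_nim_sequence (S : {fset nat}) (p : nat) (W : seq nat) : Prop :=
  [/\ size W = p, periodic_with_period S p
    & forall n, nim_value S n = nth 0 W (n %% p)].

Definition expansion (S : {fset nat}) : set nat :=
  [set s | 1 <= s /\ forall n, nim_value S (n + s) <> nim_value S n].

Definition period_closure (X : set nat) (p : nat) : set nat :=
  [set y | exists x m, X x /\ y = x + m * p].

(* The second alternative is available only when the game is periodic. *)
Definition non_expandable (S : {fset nat}) : Prop :=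
  expansion S = [set` S] \/
  exists2 p, periodic_with_period S p &
    expansion S = period_closure [set` S] p.

(* Main.v *)
(** The word is shown to obey the mex recurrence: letters at cyclic distance in
    [S] differ, and below every letter [k] the smaller values are reached by
    moves that do not wrap around the word, so that the boundary at [0] plays no
    role.  Since [a + (3a+2) = 2 (2a+1) = 4a+2], the set [S] is symmetric modulo
    the period, and for every other residue [d] two zeros of the word (among the
    positions [0..a-1], [2a], [3a+1]) lie at cyclic distance [d]. *)
Require Import Defs.
From HB Require Import structures.
From mathcomp Require Import all_boot.
From mathcomp Require Import finmap.
From mathcomp Require Import boolp classical_sets.
From mathcomp Require Import zify.

Set Implicit Arguments.
Unset Strict Implicit.
Unset Printing Implicit Defensive.

Local Open Scope classical_set_scope.
Local Open Scope nat_scope.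

(** * Nim-values as the only solution of the mex conditions *)

Lemma mex_eq (s : seq nat) (m : nat) :
  m \notin s -> (forall k, k < m -> k \in s) -> mex s = m.
Proof.
move=> ms lt_ms; have [Ns lt_s] := mexP s.
case: (ltngtP (mex s) m) => // [/lt_ms|/lt_s] h; first by rewrite h in Ns.
by rewrite h in ms.
Qed.

(** By strong induction: the first condition keeps [f n] out of the options of [n], the second puts
    every smaller value among them. Since the first is phrased with [n + s], it can be checked on
    residues, without a boundary case at [0]. *)
Lemma nim_value_unique (S : {fset nat}) (f : nat -> nat) : 0 \notin S ->
    (forall n s, s \in S -> f (n + s) <> f n) ->
    (forall n k, k < f n -> exists2 s, s \in S & s <= n /\ f (n - s) = k) ->
  forall n, nim_value S n = f n.
Proof.
move=> S0 fS flt; elim/ltn_ind=> n IHn; rewrite nim_valueE //.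
have -> : [seq nim_value S (n - s) | s <- S & s <= n]
        = [seq f (n - s) | s <- S & s <= n].
  apply/eq_in_map => s; rewrite mem_filter => /andP[le_sn sS].
  apply: IHn; case: s sS le_sn => [s0|s _ le_sn]; last by lia.
  by case/negP: S0.
apply: mex_eq => [|k /flt [s sS [le_sn <-]]].
  apply/mapP => -[s]; rewrite mem_filter => /andP[le_sn sS].
  by have := fS (n - s) s sS; rewrite subnK.
by apply: map_f; rewrite mem_filter le_sn.
Qed.

Lemma nim_valueD_neq (S : {fset nat}) (n s : nat) :
  0 \notin S -> s \in S -> nim_value S (n + s) <> nim_value S n.
Proof.
move=> S0 sS eqG.
have [Ns _] := mexP [seq nim_value S (n + s - t) | t <- S & t <= n + s].
case/negP: Ns; rewrite -nim_valueE // eqG; apply/mapP; exists s.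
  by rewrite mem_filter leq_addl.
by rewrite addnK.
Qed.

(** * The word and its letters *)

Definition word (a : nat) : seq nat :=
  nseq a 0 ++ nseq a 1 ++ [:: 0] ++ nseq (a - 1) 2 ++ [:: 1] ++ [:: 0]
  ++ nseq (a - 2) 3 ++ [:: 2] ++ [:: 1].

Definition letter (a r : nat) : nat := nth 0 (word a) r.

Lemma size_word (a : nat) : 2 <= a -> size (word a) = 4 * a + 2.
Proof. by move=> ha; rewrite /word !size_cat !size_nseq /=; lia. Qed.

(** For [2 <= a] these position sets are disjoint and cover all [r < 4 * a + 2]; being linear, they
    reduce claims about letters to case splits closed by [lia]. *)
Variant letter_spec (a r : nat) : nat -> Prop :=
| Letter0 of r < a \/ r = 2 * a \/ r = 3 * a + 1 : letter_spec a r 0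
| Letter1 of a <= r < 2 * a \/ r = 3 * a \/ r = 4 * a + 1 : letter_spec a r 1
| Letter2 of 2 * a < r < 3 * a \/ r = 4 * a : letter_spec a r 2
| Letter3 of 3 * a + 1 < r < 4 * a : letter_spec a r 3.

Lemma letterP (a r : nat) :
  2 <= a -> r < 4 * a + 2 -> letter_spec a r (letter a r).
Proof.
move=> ha hr; rewrite /letter /word.
rewrite nth_cat nth_nseq size_nseq; have [h0|h0] := ltnP r a.
  by constructor 1; lia.
rewrite nth_cat nth_nseq size_nseq; have [h1|h1] := ltnP (r - a) a.
  by constructor 2; lia.
case E: (r - a - a) => [|i] /=; first by constructor 1; lia.
rewrite nth_cat nth_nseq size_nseq; have [h2|h2] := ltnP i (a - 1).
  by constructor 3; lia.
case F: (i - (a - 1)) => [|[|k]] /=.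
- by constructor 2; lia.
- by constructor 1; lia.
rewrite nth_cat nth_nseq size_nseq; have [h3|h3] := ltnP k (a - 2).
  by constructor 4; lia.
case G: (k - (a - 2)) => [|[|l]] /=.
- by constructor 3; lia.
- by constructor 2; lia.
by lia.
Qed.

Lemma letter_uniq (a r k : nat) : 2 <= a -> r < 4 * a + 2 ->
  letter_spec a r k -> letter a r = k.
Proof. by move=> ha hr; case: (letterP ha hr) => h [] h' //; lia. Qed.

(** One wrap around the word is enough, as every [s] is below its length. *)
Lemma letter_neq (a x y s : nat) : 2 <= a -> x < 4 * a + 2 -> y < 4 * a + 2 ->
  [\/ s = a, s = 2 * a + 1 | s = 3 * a + 2] ->
  x + s = y \/ x + s = y + (4 * a + 2) -> letter a y <> letter a x.
Proof.
move=> ha hx hy hs hxy.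
case: (letterP ha hx) => hx'; case: (letterP ha hy) => hy' //.
all: by case: hs => hs; case: hxy => hxy; lia.
Qed.

Lemma letter_lt (a r k : nat) : 2 <= a -> r < 4 * a + 2 -> k < letter a r ->
  exists2 s, [\/ s = a, s = 2 * a + 1 | s = 3 * a + 2]
    & s <= r /\ letter a (r - s) = k.
Proof.
move=> ha hr hk.
suff [h|[h|h]] : (a <= r /\ letter_spec a (r - a) k) \/
    (2 * a + 1 <= r /\ letter_spec a (r - (2 * a + 1)) k) \/
    (3 * a + 2 <= r /\ letter_spec a (r - (3 * a + 2)) k).
- exists a; first by constructor 1.
  by case: h => le_r /letter_uniq ->; try split; lia.
- exists (2 * a + 1); first by constructor 2.
  by case: h => le_r /letter_uniq ->; try split; lia.
- exists (3 * a + 2); first by constructor 3.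
  by case: h => le_r /letter_uniq ->; try split; lia.
(* Subtracting [a] lowers each positive letter by exactly 1. A 3 reaches 1 by [2 * a + 1] and 0 by
   [3 * a + 2]. A 2 reaches 0 by [2 * a + 1] from inside its block, and by [3 * a + 2] from position
   [4 * a]. *)
case: (letterP ha hr) hk => //.
- move=> h; case: k => // _; left; split; first lia.
  by constructor 1; lia.
- move=> [] h; case: k => [|[|//]] _.
  + by right; left; split; [lia|constructor 1; lia].
  + by left; split; [lia|constructor 2; lia].
  + by right; right; split; [lia|constructor 1; lia].
  + by left; split; [lia|constructor 2; lia].
- move=> h; case: k => [|[|[|//]]] _.
  + by right; right; split; [lia|constructor 1; lia].
  + by right; left; split; [lia|constructor 2; lia].
  + by left; split; [lia|constructor 3; lia].
Qed.

(** * Nim-sequence, least period and expansion of the game *)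

Section Game.
Variable a : nat.
Hypothesis ha : 2 <= a.
Let S : {fset nat} := [fset a; (2 * a + 1)%N; (3 * a + 2)%N]%fset.
Let p := 4 * a + 2.

Let p_gt0 : 0 < p. Proof. by rewrite /p; lia. Qed.

Lemma mem_S (s : nat) :
  (s \in S) <-> [\/ s = a, s = 2 * a + 1 | s = 3 * a + 2].
Proof.
rewrite !inE -orbA; split.
  by case/or3P => /eqP; [constructor 1|constructor 2|constructor 3].
by case=> ->; rewrite eqxx ?orbT.
Qed.

Lemma zero_notin_S : 0 \notin S.
Proof. by apply/negP => /mem_S; case; lia. Qed.

Lemma nim_value_letter (n : nat) : nim_value S n = letter a (n %% p).
Proof.
move: n; apply: nim_value_unique => [|n s /mem_S sS|n k].
- exact: zero_notin_S.
- have hx := ltn_pmod n p_gt0; have hy := ltn_pmod (n + s) p_gt0.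
  apply: (letter_neq ha hx hy sS); rewrite -/p.
  have ls : s < p by rewrite /p; case: sS; lia.
  rewrite -(modnDml n); case: (ltnP (n %% p + s) p) => h.
    by left; rewrite [RHS]modn_small.
  right; rewrite -[in RHS](subnK h) modnDr (@modn_small (_ - p)); last by lia.
  by rewrite subnK.
- have hr := ltn_pmod n p_gt0.
  move=> /(letter_lt ha hr) [s sS [le_s <-]].
  exists s; first exact/mem_S.
  split; first exact: leq_trans le_s (leq_mod _ _).
  (* As [s <= n %% p], the subtraction leaves the quotient by [p] unchanged. *)
  congr letter; rewrite {1}(divn_eq n p) -addnBA // modnMDl modn_small //.
  by lia.
Qed.

Lemma nim_value_small (r : nat) : r < p -> nim_value S r = letter a r.
Proof. by move=> hr; rewrite nim_value_letter modn_small. Qed.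

Lemma nim_valueDMp (n m : nat) : nim_value S (n + m * p) = nim_value S n.
Proof. by rewrite !nim_value_letter addnC modnMDl. Qed.

Lemma nim_value_spec (r k : nat) :
  r < p -> letter_spec a r k -> nim_value S r = k.
Proof. by move=> hr hk; rewrite nim_value_small // (letter_uniq ha hr hk). Qed.

Lemma nim_value_zero (r : nat) :
  r < a \/ r = 2 * a \/ r = 3 * a + 1 -> nim_value S r = 0.
Proof.
by move=> hr; apply: nim_value_spec; [rewrite /p; lia | constructor 1].
Qed.

Lemma nim_value_p : nim_value S p = 0.
Proof.
by rewrite nim_value_letter modnn -nim_value_small ?nim_value_zero; lia.
Qed.

(** A shorter period [q] must be the position of a zero, because the word starts with 0; for each
    such [q], shifting a suitable zero by [q] lands on a nonzero letter. *)
Lemma period_word : periodic_with_period S p.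
Proof.
split; first by split=> // n; rewrite -{1}(mul1n p) nim_valueDMp.
move=> q [q_gt0 hq]; rewrite leqNgt; apply/negP => lt_qp.
have := hq 0; rewrite add0n (nim_value_zero (r := 0)); last by lia.
rewrite nim_value_small //.
case: (letterP ha lt_qp) => // -[lt_qa|[eq_q|eq_q]] _.
- have := hq (2 * a); rewrite [RHS]nim_value_zero; last by lia.
  by rewrite (nim_value_spec (k := 2)); [|rewrite /p; lia|constructor; lia].
- have := hq 1; rewrite [RHS]nim_value_zero; last by lia.
  by rewrite (nim_value_spec (k := 2)); [|rewrite /p; lia|constructor; lia].
- have := hq 1; rewrite [RHS]nim_value_zero; last by lia.
  have lt_q1 : 1 + q < p by rewrite /p; lia.
  (* Position [3 * a + 2] holds 3 if [a > 2], but 2 if [a = 2], where the block of 3s is empty. *)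
  by rewrite nim_value_small //; case: (letterP ha lt_q1) => // ?; lia.
Qed.

Lemma same_value_residue (d : nat) : d < p -> d \notin S ->
  exists n, nim_value S (n + d) = nim_value S n.
Proof.
move=> lt_dp dS.
have [da db dc] : [/\ d <> a, d <> 2 * a + 1 & d <> 3 * a + 2].
  by split=> hd; case/negP: dS; apply/mem_S; rewrite hd;
     [constructor 1|constructor 2|constructor 3].
(* After [d < a], the target [n + d] is in turn the zero at [2 * a], [3 * a + 1] or [p]. In each
   range [n < a]; the excluded residues are those that would give [n = a], the first 1. *)
rewrite /p in lt_dp; have [?|?] := ltnP d a.
  by exists 0; rewrite !nim_value_zero //; lia.
have [?|?] := ltnP d (2 * a + 1).
  by exists (2 * a - d); rewrite !nim_value_zero //; lia.
have [?|?] := ltnP d (3 * a + 2).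
  by exists (3 * a + 1 - d); rewrite !nim_value_zero //; lia.
exists (p - d); rewrite subnK ?nim_value_p ?nim_value_zero //; rewrite /p; lia.
Qed.

Lemma expansion_word : expansion S = period_closure [set` S] p.
Proof.
apply/seteqP; split=> [s [_ hs]|_ [s [m [/= sS ->]]]].
  exists (s %% p), (s %/ p); split; last by rewrite addnC -divn_eq.
  (* A coincidence at distance [s %% p] persists at distance [s], by periodicity. *)
  rewrite /=; apply: contraT => /(same_value_residue (ltn_pmod s p_gt0)) [n].
  by move: (hs n); rewrite {1}(divn_eq s p) (addnC (_ * _)) addnA nim_valueDMp.
split=> [|n]; first by move/mem_S: sS; case; lia.
by rewrite addnA nim_valueDMp; apply: nim_valueD_neq => //; exact: zero_notin_S.
Qed.

End Game.

Theorem theorem6p2 (a : nat) (ha : 2 <= a) :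
  has_nim_sequence [fset a; (2 * a + 1)%N; (3 * a + 2)%N]%fset (4 * a + 2)
    (nseq a 0 ++ nseq a 1 ++ [:: 0] ++ nseq (a - 1) 2 ++ [:: 1] ++ [:: 0]
     ++ nseq (a - 2) 3 ++ [:: 2] ++ [:: 1])
  /\ non_expandable [fset a; (2 * a + 1)%N; (3 * a + 2)%N]%fset.
Proof.
split; last first.
  (* The expansion also contains [a + (4 * a + 2)], so it is larger than the subtraction set. *)
  by right; exists (4 * a + 2); [exact: period_word|exact: expansion_word].
split=> [||n]; [exact: size_word|exact: period_word|].
exact: nim_value_letter.
Qed.
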